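(* Let $\mathcal{T}\in\operatorname{End}^*_{\mathcal{A}}(\mathcal{H})$ be invertible on $\mathcal{H}$, and let $\mathcal{X},\mathcal{Y}:\Omega\to\mathcal{H}$ be mappings. Then the following statements are equivalent: (1) $(\mathcal{X},\mathcal{Y})$ is a continuous biframe for $\mathcal{H}$ with respect to $(\Omega,\mu)$; (2) $(\mathcal{T}\mathcal{X},\mathcal{T}\mathcal{Y})$ is a continuous biframe for $\mathcal{H}$ with respect to $(\Omega,\mu)$.
   Context: $\mathcal{A}$ is a unital $C^*$-algebra, $\mathcal{H}$ is a (left) Hilbert $\mathcal{A}$-module with $\mathcal{A}$-valued inner product $\langle\cdot,\cdot\rangle_{\mathcal{A}}$ ($\mathcal{A}$-linear in the first variable), $\operatorname{End}^*_{\mathcal{A}}(\mathcal{H})$ is the set of adjointable operators $\mathcal{H}\to\mathcal{H}$, and $(\Omega,\mu)$ is a measure space with positive measure. Inequalities between elements of $\mathcal{A}$ refer to the usual order of self-adjoint elements; integrals of $\mathcal{A}$-valued functions are Banach-space-valued (Bochner type) integrals. $\mathcal{T}\mathcal{X}$ denotes the mapping $\omega\mapsto\mathcal{T}(\mathcal{X}(\omega))$. A pair $(\mathcal{X},\mathcal{Y})$ of mappings $\mathcal{X},\mathcal{Y}:\Omega\to\mathcal{H}$ is a continuous biframe for $\mathcal{H}$ with respect to $(\Omega,\mu)$ if (i) for all $f\in\mathcal{H}$ the functions $\omega\mapsto\langle f,\mathcal{X}(\omega)\rangle_{\mathcal{A}}$ and $\omega\mapsto\langle f,\mathcal{Y}(\omega)\rangle_{\mathcal{A}}$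 are measurable on $\Omega$, and (ii) there exist constants $0<A\le B<\infty$ such that for all $f\in\mathcal{H}$, $$A\langle f,f\rangle_{\mathcal{A}}\le\int_\Omega\langle f,\mathcal{X}(\omega)\rangle_{\mathcal{A}}\langle\mathcal{Y}(\omega),f\rangle_{\mathcal{A}}\,d\mu\le B\langle f,f\rangle_{\mathcal{A}}.$$ *)

(* Defs.v *)
From HB Require Import structures.
From mathcomp Require Import all_boot all_order all_algebra.
From mathcomp Require Import all_classical all_reals all_analysis.
From mathcomp Require Import complex.

Set Implicit Arguments.
Unset Strict Implicit.
Unset Printing Implicit Defensive.

Import Order.TTheory GRing.Theory Num.Theory.
Import numFieldNormedType.Exports.

Local Open Scope classical_set_scope.
Local Open Scope ring_scope.
Local Open Scope complex_scope.

(* The library structures of rings and of normed groups over another field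
   cannot be joined on one carrier (their only join is numDomainType), so the
   norm N : V -> R of a C*-algebra is carried explicitly, and so are the
   topological notions that derive from it. *)
Section NormTopology.
Context {R : realType} {V : zmodType}.
Variable N : V -> R.

Definition norm_cvg (u : nat -> V) (l : V) : Prop :=
  N (u n - l) @[n --> \oo] --> (0 : R).

Definition norm_cauchy (u : nat -> V) : Prop :=
  forall e : R, 0 < e -> \forall m & n \near \oo, N (u m - u n) < e.

Definition norm_complete : Prop :=
  forall u : nat -> V, norm_cauchy u -> exists l : V, norm_cvg u l.

Definition norm_open : set (set V) :=
  [set U | forall x, U x ->
     exists2 e : R, 0 < e & forall y, N (y - x) < e -> U y].

End NormTopology.

HB.mixin Record isCstarAlgebra (R : realType) A of GRing.Algebra R[i] A := {
  cnorm : A -> R;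
  cnormD : forall a b, cnorm (a + b) <= cnorm a + cnorm b;
  cnormZ : forall (k : R[i]) a, (cnorm (k *: a))%:C = `|k| * (cnorm a)%:C;
  cnorm0_eq0 : forall a, cnorm a = 0 -> a = 0;
  cnormM : forall a b, cnorm (a * b) <= cnorm a * cnorm b;
  cnorm_complete : norm_complete cnorm;
  cstar : A -> A;
  cstarD : forall a b, cstar (a + b) = cstar a + cstar b;
  cstarZ : forall (k : R[i]) a, cstar (k *: a) = Num.conj k *: cstar a;
  cstarM : forall a b, cstar (a * b) = cstar b * cstar a;
  cstarK : forall a, cstar (cstar a) = a;
  cnorm_cstar : forall a, cnorm (cstar a * a) = cnorm a ^+ 2
}.

(* Unital C*-algebras over the complex numbers R[i]. *)
#[short(type="cstarAlgType")]
HB.structure Definition CstarAlgebra (R : realType) :=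
  {A of GRing.Algebra R[i] A & isCstarAlgebra R A}.

Section CstarOrder.
Context {R : realType} {A : cstarAlgType R}.

Definition spectrum (a : A) : set R[i] :=
  [set l | ~ exists b : A, (l%:A - a) * b = 1 /\ b * (l%:A - a) = 1].

(* In R[i], 0 <= l means that l is real and nonnegative. *)
Definition cpositive (a : A) : Prop :=
  cstar a = a /\ forall l : R[i], spectrum a l -> 0 <= l.

Definition cle (a b : A) : Prop := cpositive (b - a).

End CstarOrder.

(* Left Hilbert A-modules; a complex scalar k acts on H as k%:A. *)
HB.mixin Record isHilbertModule (R : realType) (A : cstarAlgType R) H
    of GRing.Lmodule A H := {
  hinner : H -> H -> A;
  hinner_linearl : forall (a : A) (f g h : H),
    hinner (a *: f + g) h = a * hinner f h + hinner g h;
  hinner_sym : forall f g : H, cstar (hinner f g) = hinner g f;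
  hinner_ge0 : forall f : H, cpositive (hinner f f);
  hinner_eq0 : forall f : H, hinner f f = 0 -> f = 0;
  hinner_complete :
    norm_complete (fun f : H => Num.sqrt (cnorm (hinner f f)))
}.

#[short(type="hilbertModType")]
HB.structure Definition HilbertModule (R : realType) (A : cstarAlgType R) :=
  {H of GRing.Lmodule A H & isHilbertModule R A H}.

(* The existence of an adjoint forces A-linearity and boundedness. *)
Definition adjointable {R : realType} {A : cstarAlgType R}
    {H : hilbertModType A} (T : H -> H) : Prop :=
  exists S : H -> H, forall f g : H, hinner (T f) g = hinner f (S g).

Section Bochner.
Context {R : realType} {A : cstarAlgType R}.
Context {d : measure_display} {Omega : measurableType d}.
Variable mu : {measure set Omega -> \bar R}.

Definition borel_measurable (F : Omega -> A) : Prop :=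
  measurable_fun [set: Omega]
    (F : Omega -> g_sigma_algebraType (norm_open (@cnorm R A))).

Definition integrable_simple (s : Omega -> A) : Prop :=
  [/\ finite_set (range s), borel_measurable s
    & (mu (s @^-1` (~` [set 0%R])) < +oo)%E].

(* The value 0 contributes 0, even when its preimage has infinite measure. *)
Definition simple_integral (s : Omega -> A) : A :=
  \sum_(a \in range s) (fine (mu (s @^-1` [set a])))%:C *: a.

Definition is_bochner_integral (F : Omega -> A) (v : A) : Prop :=
  exists s : nat -> Omega -> A,
    [/\ forall n, integrable_simple (s n),
        {ae mu, forall w, norm_cvg (@cnorm R A) (s ^~ w) (F w)},
        (\int[mu]_w (cnorm (F w - s n w))%:E)%E @[n --> \oo] --> 0%E
      & norm_cvg (@cnorm R A) (simple_integral \o s) v].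

Definition bochner_integrable (F : Omega -> A) : Prop :=
  exists v, is_bochner_integral F v.

(* Junk value 0 when F is not Bochner integrable. *)
Definition bochner_integral (F : Omega -> A) : A :=
  xget 0 [set v | is_bochner_integral F v].

End Bochner.

Definition continuous_biframe {R : realType} {A : cstarAlgType R}
    {H : hilbertModType A} {d : measure_display} {Omega : measurableType d}
    (mu : {measure set Omega -> \bar R}) (X Y : Omega -> H) : Prop :=
  (forall f : H, borel_measurable (fun w => hinner f (X w)) /\
                 borel_measurable (fun w => hinner f (Y w))) /\
  exists a b : R, [/\ 0 < a, a <= b &
    forall f : H,
      let F := fun w => hinner f (X w) * hinner (Y w) f in
      [/\ bochner_integrable mu F,
          cle (a%:C *: hinner f f) (bochner_integral mu F)
        & cle (bochner_integral mu F) (b%:C *: hinner f f)]].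

(* Main.v *)
Require Import Defs.
From mathcomp Require Import all_boot all_order all_algebra.
From mathcomp Require Import all_classical all_reals all_analysis.
From mathcomp Require Import complex ring lra.

Set Implicit Arguments.
Unset Strict Implicit.
Unset Printing Implicit Defensive.

Import Order.TTheory GRing.Theory Num.Theory.
Import numFieldNormedType.Exports.

Local Open Scope classical_set_scope.
Local Open Scope ring_scope.

(** The adjoint [S] of [T] moves [T] across the inner product:
    <f, T X> <T Y, f> = <S f, X> <Y, S f>.  Hence measurability and
    integrability for [(T X, T Y)] at [f] are those for [(X, Y)] at [S f], with
    the same integral, and only the comparison of <S f, S f> with <f, f> in the
    order of the algebra remains.  The upper bound <S f, S f> <= c <f, f> holds
    for every operator with an adjoint ([adjoint_pair_cle]); the lower bound is
    the same fact for the inverse of [S], once [S] is known to be bijective with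
    inverse adjoint to the inverse of [T] ([adjointable_inverse]).  The converse
    implication is the direct one for the inverse of [T].

    The order is defined through the spectrum, so its properties rest on the
    fact that a nonzero self-adjoint [a] has [|a|] or [-|a|] in its spectrum
    ([cnorm_in_spectrum]).  The proof given here uses no complex analysis.
    If [|b| = 1] and [1 - b^2] had an inverse [c], then, for small [d], the
    element [1 - b^2 - d = (1 - b^2) (1 - d c)] would be close to a square [h^2]
    of a self-adjoint element, and [|r - h^2| <= r] holds whenever
    [|h^2| < 2 r] because, after rescaling, [2 h^2 - 1] is the real part of the
    square of the unitary [h + i sqrt (1 - h^2)] ([cnorm_reflect]).  For
    [r = 1 - d] this gives [|b^2| < 1].  It follows that positive elements form
    a closed cone and that the norm is monotone, whence the Cauchy-Schwarz
    inequality with constant 2 ([cauchy_schwarz]) and the triangle inequality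
    for the norm of the module.

    Boundedness of operators with an adjoint comes from the uniform boundedness
    principle ([uniform_boundedness]).  If [X] is a symmetric contraction, then
    2 <X f, f> <= <f, f> + <X^2 f, f>, and iterating this over [X], [X^2],
    [X^4], ... gives <X f, f> <= <f, f> ([cle_symmetric_contraction]); applied
    to a multiple of [S T] this is [adjoint_pair_cle].

    Surjectivity of [S] is where a Hilbert module differs from a Hilbert space:
    closed submodules need not have complements.  Instead, [T S + t] is bounded
    below uniformly in [t >= 0] and is surjective for large [t]; steps of fixed
    length carry surjectivity down to [t = 0] ([adjoint_surjective]). *)

(** * Contractions for a complete norm *)

Lemma geometric_tail_small {R : realType} (C q : R) :
  0 <= q < 1 -> forall e, 0 < e -> exists n, C * q ^+ n / (1 - q) < e.
Proof.
move=> /andP[q0 q1] e e0.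
have : geometric (C / (1 - q)) q @ \oo --> (0 : R).
  by apply: cvg_geometric; rewrite ger0_norm.
move=> /cvgrPdist_lt /(_ e e0) [n _ /(_ n (leqnn _))] /=.
rewrite sub0r normrN => /(le_lt_trans (ler_norm _)) ne.
by exists n; move: ne; rewrite mulrAC.
Qed.

Section CompleteNorm.
Context {R : realType} {V : zmodType}.
Variable N : V -> R.

Record is_norm : Prop := IsNorm {
  is_norm0 : N 0 = 0;
  is_normN : forall x, N (- x) = N x;
  is_normD : forall x y, N (x + y) <= N x + N y;
  is_norm0_eq0 : forall x, N x = 0 -> x = 0
}.

Hypothesis normP : is_norm.

Lemma is_norm_ge0 x : 0 <= N x.
Proof.
have := is_normD normP x (- x).
by rewrite subrr (is_norm0 normP) (is_normN normP); lra.
Qed.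

Lemma is_normB x y : N (x - y) = N (y - x).
Proof. by rewrite -(is_normN normP) opprB. Qed.

Lemma is_norm_dist x y z : N (x - z) <= N (x - y) + N (y - z).
Proof. by have := is_normD normP (x - y) (y - z); rewrite addrA subrK. Qed.

Hypothesis completeP : norm_complete N.

Lemma geometric_step_cvg (u : nat -> V) (C q : R) :
  0 <= q < 1 -> (forall n, N (u n.+1 - u n) <= C * q ^+ n) ->
  exists l, forall n, N (l - u n) <= C * q ^+ n / (1 - q).
Proof.
move=> qP uC; have /andP[q0 q1] := qP.
have C0 : 0 <= C.
  by have := uC 0%N; rewrite expr0 mulr1; apply: le_trans; exact: is_norm_ge0.
have q1' : 0 < 1 - q by lra.
have tail n k : N (u (n + k)%N - u n) <= C * q ^+ n / (1 - q).
  have : N (u (n + k)%N - u n) <= C * q ^+ n * (1 - q ^+ k) / (1 - q).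
    elim: k => [|k IH].
      by rewrite addn0 !subrr (is_norm0 normP) mulr0 mul0r.
    rewrite addnS; apply: le_trans (is_norm_dist _ (u (n + k)%N) _) _.
    apply: le_trans (lerD (uC _) IH) _.
    rewrite ler_pdivlMr // mulrDl mulfVK ?gt_eqF // exprD exprS.
    by rewrite le_eqVlt; apply/orP; left; apply/eqP; ring.
  move=> /le_trans; apply; rewrite ler_wpM2r ?invr_ge0 ?(ltW q1') //.
  rewrite ler_piMr ?mulr_ge0 ?exprn_ge0 //.
  by rewrite lerBlDr lerDl exprn_ge0.
have [l ul] : exists l, norm_cvg N u l.
  apply: completeP => e e0.
  have [n0 n0e] := geometric_tail_small C qP (divr_gt0 e0 (ltr0Sn _ 1)).
  exists ([set n | (n0 <= n)%N], [set n | (n0 <= n)%N]).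
    by split; exists n0.
  move=> [m n] /= [mn nn].
  apply: le_lt_trans (is_norm_dist _ (u n0) _) _.
  rewrite (is_normB (u n0)) -(subnKC mn) -(subnKC nn).
  have := tail n0 (m - n0)%N; have := tail n0 (n - n0)%N; lra.
exists l => n; rewrite is_normB; apply/ler_addgt0Pr => e e0.
have /cvgrPdist_lt/(_ e e0)[k _ uk] := ul.
have := uk (k + n)%N; rewrite /= leq_addr => /(_ isT).
rewrite sub0r normrN => /(le_lt_trans (ler_norm _)) h.
apply: le_trans (is_norm_dist _ (u (k + n)%N) _) _.
by have := tail n k; rewrite (addnC n k) (is_normB (u n)); lra.
Qed.

(** Running the iteration inside a closed set [K] transfers to the fixed point
    the properties of the iterates; for a square root these are the norm bound
    that makes the map a contraction, self-adjointness and commutation. *)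
Lemma contraction_fixpoint (K : V -> Prop) (F : V -> V) (q : R) :
  0 <= q < 1 ->
  (forall l, (forall e, 0 < e -> exists2 x, K x & N (x - l) <= e) -> K l) ->
  (exists x, K x) -> (forall x, K x -> K (F x)) ->
  (forall x y, K x -> K y -> N (F x - F y) <= q * N (x - y)) ->
  exists2 l, K l & F l = l.
Proof.
move=> qP Kcl [x0 Kx0] KF Fq; have /andP[q0 q1] := qP.
pose u n := iter n F x0.
have Ku n : K (u n) by elim: n => [|n] //=; exact: KF.
have step n : N (u n.+1 - u n) <= N (u 1%N - u 0%N) * q ^+ n.
  elim: n => [|n IH]; first by rewrite expr0 mulr1.
  apply: le_trans (Fq (u n.+1) (u n) (Ku _) (Ku _)) _.
  by rewrite exprS mulrCA ler_wpM2l.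
have [l ul] := geometric_step_cvg qP step.
set C := N _ in ul.
have small := geometric_tail_small C qP.
have Kl : K l.
  apply: Kcl => e /small[n /ltW ne]; exists (u n) => //.
  by rewrite is_normB (le_trans (ul n)).
exists l => //; apply/eqP; rewrite -subr_eq0; apply/eqP.
apply: (is_norm0_eq0 normP); apply/eqP; rewrite eq_le is_norm_ge0 andbT.
apply/ler_addgt0Pr => e e0; rewrite add0r.
have [n /ltW ne] := small (e / 2) (divr_gt0 e0 (ltr0Sn _ 1)).
apply: le_trans (is_norm_dist _ (u n.+1) _) _.
have h1 : N (F l - u n.+1) <= e / 2.
  apply: le_trans (Fq _ _ Kl (Ku n)) _; apply: le_trans ne.
  apply: le_trans (ul n); rewrite ler_piMl ?is_norm_ge0 //; exact: ltW.
have h2 : N (u n.+1 - l) <= e / 2.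
  rewrite is_normB (le_trans (ul _)) // (le_trans _ ne) //.
  rewrite ler_wpM2r ?invr_ge0 ?subr_ge0 ?(ltW q1) //.
  rewrite ler_wpM2l ?is_norm_ge0 // exprS ler_piMl ?exprn_ge0 //; exact: ltW.
lra.
Qed.

End CompleteNorm.

(** * C*-algebras: norm, inverses and square roots *)

Section CstarAlgebra.
Context {R : realType} {A : cstarAlgType R}.
Local Notation N := (@cnorm R A).
Implicit Types (a b c x y z : A) (k l : R[i]) (r s t : R).
Local Open Scope complex_scope.

Lemma cnormZr r a : N (r%:C *: a) = `|r| * N a.
Proof.
apply: complexI; rewrite cnormZ rmorphM /=; congr (_ * _).
by rewrite normc_def /= expr0n addr0 sqrtr_sqr.
Qed.

Lemma cnormZi a : N ('i%R *: a) = N a.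
Proof. by apply: complexI; rewrite cnormZ normCi mul1r. Qed.

Lemma cnorm_is_norm : is_norm N.
Proof.
split.
- rewrite -(scale0r (0 : A)) -(rmorph0 (real_complex R)) cnormZr.
  by rewrite normr0 mul0r.
- move=> x; rewrite -scaleN1r -(rmorph1 (real_complex R)) -rmorphN cnormZr.
  by rewrite normrN1 mul1r.
- exact: cnormD.
- exact: cnorm0_eq0.
Qed.

Lemma scaler_half x : (2^-1 : R)%:C *: (x + x) = x.
Proof.
rewrite scalerDr -scalerDl -rmorphD /=.
by rewrite (_ : 2^-1 + 2^-1 = 1 :> R) ?scale1r //; lra.
Qed.

Definition cnorm_ge0 := is_norm_ge0 cnorm_is_norm.
Definition cnormN := is_normN cnorm_is_norm.
Definition cnormB := is_normB cnorm_is_norm.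

Lemma cnorm_triB x y : N (x - y) <= N x + N y.
Proof. by rewrite (le_trans (cnormD _ _)) // cnormN. Qed.

Lemma cstar0 : cstar (0 : A) = 0.
Proof. by apply: (@addIr _ (cstar (0 : A))); rewrite add0r -cstarD add0r. Qed.

Lemma cstarN a : cstar (- a) = - cstar a.
Proof. by apply/eqP; rewrite -subr_eq0 opprK -cstarD addNr cstar0. Qed.

Lemma cstarB a b : cstar (a - b) = cstar a - cstar b.
Proof. by rewrite cstarD cstarN. Qed.

Lemma cstar1 : cstar (1 : A) = 1.
Proof. by rewrite -[LHS]mulr1 -{2}(cstarK (1 : A)) -cstarM mulr1 cstarK. Qed.

Lemma cstarZr r a : cstar (r%:C *: a) = r%:C *: cstar a.
Proof. by rewrite cstarZ conj_Creal // complex_real. Qed.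

Lemma cstarZi a : cstar ('i%R *: a) = - ('i%R *: cstar a).
Proof. by rewrite cstarZ conjCi scaleNr. Qed.

Lemma cnorm_star a : N (cstar a) = N a.
Proof.
have h b : N b <= N (cstar b).
  have := cnormM (cstar b) b; rewrite cnorm_cstar expr2.
  have := cnorm_ge0 b; rewrite le_eqVlt => /orP[/eqP<- _|b0].
    exact: cnorm_ge0.
  by rewrite ler_pM2r.
by apply/eqP; rewrite eq_le h andbT -{2}(cstarK a) h.
Qed.

Lemma cnorm_sqr a : cstar a = a -> N (a * a) = N a ^+ 2.
Proof. by move=> aP; rewrite -cnorm_cstar aP. Qed.

Lemma cnorm1 : N 1 = 1.
Proof.
have := cnorm_sqr cstar1; rewrite mulr1 => /esym/eqP.
rewrite -subr_eq0 expr2 -{3}[N 1]mulr1 -mulrBr mulf_eq0 subr_eq0.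
case/orP => /eqP // /cnorm0_eq0 /eqP; by rewrite oner_eq0.
Qed.

Lemma cnorm_real r : N (r%:C%:A) = `|r|.
Proof. by rewrite cnormZr cnorm1 mulr1. Qed.

Lemma cnorm_small0 a r : (forall e, 0 < e -> N a <= r * e) -> a = 0.
Proof.
move=> ar; apply: cnorm0_eq0; apply/eqP; rewrite eq_le cnorm_ge0 andbT.
apply/ler_addgt0Pr => e e0; rewrite add0r.
have r0 : 0 < `|r| + 1 by have := normr_ge0 r; lra.
apply: le_trans (ar (e / (`|r| + 1)) _) _; first exact: divr_gt0.
rewrite mulrCA ler_piMr ?(ltW e0) // ler_pdivrMr // mul1r.
by have := ler_norm r; lra.
Qed.

Definition cinvertible a := exists b, a * b = 1 /\ b * a = 1.

Lemma inverse_uniq a b c : b * a = 1 -> a * c = 1 -> b = c.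
Proof. by move=> ba ac; rewrite -[b]mulr1 -ac mulrA ba mul1r. Qed.

Lemma cinvertibleM a b : cinvertible a -> cinvertible b -> cinvertible (a * b).
Proof.
move=> [a' [aa a'a]] [b' [bb b'b]]; exists (b' * a').
by rewrite mulrA -(mulrA a) bb mulr1 aa mulrA -(mulrA b') a'a mulr1 b'b.
Qed.

Lemma cinvertibleZ k a : k != 0 -> cinvertible a -> cinvertible (k *: a).
Proof.
move=> k0 [b [ab ba]]; exists (k^-1 *: b).
by rewrite -!scalerAl -!scalerAr !scalerA ab ba mulVf // mulfV // scale1r.
Qed.

(** A right inverse solves [y = 1 + x y] and a left inverse [z = 1 + z x]; both
    right-hand sides are contractions. *)
Lemma cinvertible_oneB x : N x < 1 -> cinvertible (1 - x).
Proof.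
move=> x1.
have fix_point (F : A -> A) :
    (forall y z, N (F y - F z) <= N x * N (y - z)) -> exists y, F y = y.
  move=> FP.
  have [|||||y _ ?] := contraction_fixpoint cnorm_is_norm cnorm_complete
    (K := fun=> True) (F := F) (q := N x); rewrite ?cnorm_ge0 //.
  by exists y.
have [y yP] : exists y, 1 + x * y = y.
  apply: fix_point => y z.
  by rewrite opprD addrACA subrr add0r -mulrBr cnormM.
have [z zP] : exists z, 1 + z * x = z.
  apply: fix_point => y' z.
  by rewrite opprD addrACA subrr add0r -mulrBl mulrC cnormM.
have yR : (1 - x) * y = 1 by rewrite mulrBl mul1r -{1}yP addrK.
have zL : z * (1 - x) = 1 by rewrite mulrBr mulr1 -{1}zP addrK.
by exists y; rewrite -{2}(inverse_uniq zL yR).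
Qed.

Lemma spectrum_le_cnorm a l : spectrum a l -> `|l| <= (N a)%:C.
Proof.
move=> la; rewrite real_leNgt ?normr_real //; last by rewrite complex_real.
apply/negP => al; apply: la.
have l0 : l != 0.
  by apply: contraTneq al => ->; rewrite normr0 ltcR -leNgt cnorm_ge0.
have -> : l%:A - a = l *: (1 - l^-1 *: a).
  by rewrite scalerBr scalerA mulfV // scale1r.
apply: (cinvertibleZ l0); apply: cinvertible_oneB; rewrite -ltcR cnormZ normfV.
by rewrite ltr_pdivrMl ?normr_gt0 // mulr1.
Qed.

(** The equation [f^2 = 1 - x] for [f = 1 - y] reads [y = (x + y^2) / 2], whose
    right-hand side is a contraction of constant [|x|] on the ball of radius
    [|x|]. *)
Lemma sqrt_one_minus x : cstar x = x -> N x < 1 ->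
  exists f, [/\ cstar f = f, f * f = 1 - x
    & forall z, GRing.comm z x -> GRing.comm z f].
Proof.
move=> xs x1.
pose F y := (2^-1 : R)%:C *: (x + y * y).
pose K y := [/\ cstar y = y, N y <= N x
  & forall z, GRing.comm z x -> GRing.comm z y].
have half : `|2^-1 : R| = 2^-1 by rewrite ger0_norm // invr_ge0.
have x0 := cnorm_ge0 x.
have [|||||y [ys yx yc] yP] := contraction_fixpoint cnorm_is_norm cnorm_complete
    (K := K) (F := F) (q := N x); rewrite ?cnorm_ge0 //.
- move=> l lP; split.
  + apply/eqP; rewrite -subr_eq0; apply/eqP; apply: (@cnorm_small0 _ 2) => e e0.
    have [y [ys _ _] ye] := lP e e0.
    have -> : cstar l - l = cstar (l - y) + (y - l).
      by rewrite cstarB ys addrA subrK.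
    apply: le_trans (cnormD _ _) _; rewrite cnorm_star cnormB; lra.
  + apply/ler_addgt0Pr => e e0; have [y [_ yx _] ye] := lP e e0.
    have := cnormD y (l - y); rewrite addrC subrK cnormB; lra.
  + move=> z zx; apply/eqP; rewrite -subr_eq0; apply/eqP.
    apply: (@cnorm_small0 _ (2 * N z)) => e e0.
    have [y [_ _ /(_ _ zx) zy] ye] := lP e e0.
    have -> : z * l - l * z = z * (l - y) + (y - l) * z.
      by rewrite mulrBr mulrBl zy addrA subrK.
    apply: le_trans (cnormD _ _) _.
    apply: le_trans (lerD (cnormM _ _) (cnormM _ _)) _.
    have := ler_wpM2l (cnorm_ge0 z) ye; rewrite (cnormB l); lra.
- exists 0; split; rewrite ?cstar0 // ?(is_norm0 cnorm_is_norm) //.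
  by move=> z _; exact: commr0.
- move=> y [ys yx yc]; split.
  + by rewrite cstarZr cstarD cstarM xs ys.
  + rewrite cnormZr half.
    have := cnormD x (y * y); have := cnormM y y.
    have : N y * N y <= N x * 1.
      by rewrite ler_pM ?cnorm_ge0 // (le_trans yx) // ltW.
    lra.
  + move=> z zx; rewrite /GRing.comm -scalerAr -scalerAl; congr (_ *: _).
    by apply: commrD => //; apply: commrM; exact: yc.
- move=> y z [_ yx _] [_ zx _].
  have -> : F y - F z = (2^-1 : R)%:C *: (y * (y - z) + (y - z) * z).
    rewrite /F -scalerBr opprD addrACA subrr add0r mulrBr mulrBl.
    by rewrite addrA subrK.
  rewrite cnormZr half.
  have := cnormD (y * (y - z)) ((y - z) * z).
  have := cnormM y (y - z); have := cnormM (y - z) z.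
  have : N (y - z) * N z <= N x * N (y - z).
    by rewrite mulrC ler_wpM2r ?cnorm_ge0.
  have : N y * N (y - z) <= N x * N (y - z) by rewrite ler_wpM2r ?cnorm_ge0.
  lra.
exists (1 - y); split.
- by rewrite cstarB cstar1 ys.
- have y2 : y + y = x + y * y.
    by rewrite -{1 2}yP /F -scalerDr scaler_half.
  have yy : y * y = y + y - x by rewrite y2 addrAC subrr add0r.
  rewrite mulrBl mul1r mulrBr mulr1 opprB yy.
  by rewrite [y + y - x]addrAC addrK addrA subrK.
- by move=> z /yc; move=> zy; apply: commrB => //; exact: commr1.
Qed.

End CstarAlgebra.

(** * The spectrum of a self-adjoint element *)

Section CstarOrder.
Context {R : realType} {A : cstarAlgType R}.
Local Notation N := (@cnorm R A).
Implicit Types (a b c x y z : A) (k l : R[i]) (r s t : R).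
Local Open Scope complex_scope.

Lemma spectrum_shift a k l : spectrum a l -> spectrum (a + k%:A) (l + k).
Proof. by rewrite /spectrum /= scalerDl opprD addrACA subrr addr0. Qed.

Lemma spectrum_reflect a k l : spectrum (k%:A - a) l -> spectrum a (k - l).
Proof.
move=> sl inv; apply: sl.
have -> : l%:A - (k%:A - a) = (-1) *: ((k - l)%:A - a).
  by rewrite scaleN1r opprB scalerBl !opprB addrCA addrA.
by apply: cinvertibleZ => //; rewrite oppr_eq0 oner_eq0.
Qed.

(** Shifting [a] by [i t] moves a point [u + i v] of the spectrum to
    [u + i (v + t)], while [|a + i t|^2 = |a^2 + t^2| <= |a|^2 + t^2]; the
    inequality [u^2 + (v + t)^2 <= |a|^2 + t^2] for all real [t] forces
    [v = 0]. *)
Lemma spectrum_real a l : cstar a = a -> spectrum a l -> l = (complex.Re l)%:C.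
Proof.
move=> aS la.
have bound t : complex.Re l ^+ 2 + (complex.Im l + t) ^+ 2 <= N a ^+ 2 + t ^+ 2.
  pose k : R[i] := t%:C * 'i%R.
  have kE : k = Complex 0 t.
    by rewrite /k -complexiE; simpc.
  have := spectrum_le_cnorm (spectrum_shift (k := k) la).
  set b := a + k%:A => lb.
  have bs : cstar b = a - k%:A.
    rewrite /b cstarD aS cstarZ cstar1 /k rmorphM /= conjCi.
    by rewrite conj_Creal ?complex_real // mulrN scaleNr.
  have Nb : N b ^+ 2 <= N a ^+ 2 + t ^+ 2.
    rewrite -cnorm_cstar bs /b.
    have -> : (a - k%:A) * (a + k%:A) = a * a + (t ^+ 2)%:C%:A.
      rewrite mulrBl !mulrDr -!scalerAl -!scalerAr !mul1r !mulr1.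
      rewrite opprD addrA addrK scalerA -scaleNr; congr (_ + _ *: _).
      by rewrite /k mulrACA -!expr2 sqrCi mulrN1 opprK rmorphXn.
    apply: le_trans (cnormD _ _) _.
    by rewrite (cnorm_sqr aS) cnorm_real ger0_norm ?sqr_ge0.
  apply: le_trans Nb; rewrite -lecR.
  have -> : complex.Re l ^+ 2 + (complex.Im l + t) ^+ 2
          = complex.Re (l + k) ^+ 2 + complex.Im (l + k) ^+ 2.
    by rewrite kE; case: (l) => u v /=; rewrite addr0.
  rewrite add_Re2_Im2 rmorphXn /= lerXn2r ?nnegrE ?normr_ge0 //.
  by rewrite ler0c cnorm_ge0.
case: l la bound => u v _ /= bound; suff -> : v = 0 by [].
apply/eqP/negPn/negP => v0.
have := bound ((N a ^+ 2 + 1) / (2 * v)).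
set w := (_ / _); rewrite sqrrD -mulr_natl.
have -> : 2 * (v * w) = N a ^+ 2 + 1.
  by rewrite /w invfM mulrCA mulrA -mulrA; field.
have := sqr_ge0 u; have := sqr_ge0 v; lra.
Qed.

Lemma parallelogram_sqr x y :
  (x + y) * (x + y) + (x - y) * (x - y) = (x * x + y * y) + (x * x + y * y).
Proof.
rewrite mulrBl !mulrBr mulrDl !mulrDr opprB addrACA [X in X + _]addrACA subrr.
by rewrite addr0 [y * x + _]addrC [X in _ + X]addrACA subrr addr0 addrACA.
Qed.

(** With [g = h / sqrt (2 r)] and [f = sqrt (1 - g^2)], the element [g + i f] is
    unitary and its square has real part [2 g^2 - 1 = h^2 / r - 1], which
    therefore has norm at most 1. *)
Lemma cnorm_reflect h r : cstar h = h -> N (h * h) < 2 * r ->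
  N (r%:C%:A - h * h) <= r.
Proof.
move=> hs hr; have r0 : 0 < r by have := cnorm_ge0 (h * h); lra.
have r2 : 0 < 2 * r by lra.
pose x := ((2 * r)^-1)%:C *: (h * h).
have hh : h * h = (2 * r)%:C *: x.
  by rewrite /x scalerA -rmorphM /= mulfV ?gt_eqF // scale1r.
have xs : cstar x = x by rewrite /x cstarZr cstarM hs.
have x1 : N x < 1.
  by rewrite cnormZr ger0_norm ?invr_ge0 ?(ltW r2) // ltr_pdivrMl // mulr1.
have [f [fs ff fc]] := sqrt_one_minus xs x1.
pose g := (Num.sqrt (2 * r)^-1)%:C *: h.
have gg : g * g = x.
  rewrite /g -scalerAl -scalerAr scalerA -rmorphM /= -expr2 sqr_sqrtr //.
  by rewrite invr_ge0 ltW.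
have gs : cstar g = g by rewrite cstarZr hs.
have gf : GRing.comm g f.
  by apply: fc; rewrite /GRing.comm -gg mulrA.
pose y := 'i%R *: f.
have yy : y * y = x - 1.
  by rewrite /y -scalerAl -scalerAr scalerA -expr2 sqrCi scaleN1r ff opprB.
have gy : GRing.comm g y by rewrite /GRing.comm -scalerAr gf -scalerAl.
have us : cstar (g + y) = g - y by rewrite cstarD gs cstarZi fs.
have uu : N (g + y) <= 1.
  rewrite -(@ler_pXn2r _ 2) ?nnegrE ?cnorm_ge0 // expr1n -cnorm_cstar us.
  rewrite mulrBl !mulrDr gy opprD addrA addrK gg yy opprB addrC subrK.
  by rewrite cnorm1.
have u's : N (g - y) <= 1 by rewrite -us cnorm_star.
have := parallelogram_sqr g y; rewrite gg yy; set w := x + (x - 1) => wE.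
have Nw : N w <= 1.
  have := cnormD ((g + y) * (g + y)) ((g - y) * (g - y)); rewrite wE.
  have := cnormM (g + y) (g + y); have := cnormM (g - y) (g - y).
  have : N (g + y) * N (g + y) <= 1 * 1 by rewrite ler_pM ?cnorm_ge0.
  have : N (g - y) * N (g - y) <= 1 * 1 by rewrite ler_pM ?cnorm_ge0.
  have -> : w + w = (2%:R : R)%:C *: w.
    by rewrite rmorph_nat scaler_nat mulr2n.
  by rewrite cnormZr ger0_norm //; lra.
have -> : r%:C%:A - h * h = r%:C *: (- w).
  have -> : - w = 1 - (2%:R : R)%:C *: x.
    by rewrite rmorph_nat scaler_nat mulr2n /w addrA opprB.
  rewrite hh scalerBr [in RHS]scalerA; congr (_ - _ *: _).
  by rewrite [RHS]mulrC rmorphM.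
by rewrite cnormZr ger0_norm ?(ltW r0) // cnormN ler_piMr // (ltW r0).
Qed.

(** Let [c] be the inverse.  The bound [|b^2| <= 1 - d / 3] is obtained by
    applying [cnorm_reflect] to [h^2 = (1 - (1 - d / 3) b^2) (1 - d c)].  The
    factor [1 - d / 3] makes the square root of the first bracket exist, and
    changes [h^2] by at most [2 d / 3]. *)
Lemma oneB_sqr_not_invertible b :
  cstar b = b -> N b = 1 -> ~ cinvertible (1 - b * b).
Proof.
move=> bs b1 [c [bc cb]].
have Nbb : N (b * b) = 1 by rewrite (cnorm_sqr bs) b1 expr1n.
have cs : cstar c = c.
  have bbs : cstar (1 - b * b) = 1 - b * b by rewrite cstarB cstarM bs cstar1.
  by apply: (inverse_uniq _ bc); rewrite -{1}bbs -cstarM bc cstar1.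
have comm_bc : GRing.comm b c.
  rewrite /GRing.comm -[b * c]mul1r -cb -!mulrA; congr (c * _).
  rewrite [(1 - b * b) * (b * c)]mulrA.
  have -> : (1 - b * b) * b = b * (1 - b * b).
    by rewrite mulrBl mulrBr mul1r mulr1 mulrA.
  by rewrite -mulrA bc mulr1.
(* This gives both [d |c| < 1] and [d <= 1 / 4]. *)
pose d := (4 * (1 + N c))^-1.
have Nc := cnorm_ge0 c.
have d0 : 0 < d by rewrite invr_gt0; lra.
have dc : d * N c + d = 4^-1.
  by rewrite /d; field; rewrite gt_eqF //; lra.
have dN : 0 <= d * N c by rewrite mulr_ge0 // ltW.
have [||e [es ee ec]] := @sqrt_one_minus _ _ (d%:C *: c).
- by rewrite cstarZr cs.
- by rewrite cnormZr ger0_norm ?(ltW d0) //; lra.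
have [||f [fs ff fc]] := @sqrt_one_minus _ _ ((1 - d / 3)%:C *: (b * b)).
- by rewrite cstarZr cstarM bs.
- by rewrite cnormZr Nbb mulr1 ger0_norm; lra.
have commZ k x y : GRing.comm x y -> GRing.comm x (k *: y).
  by move=> xy; rewrite /GRing.comm -scalerAr xy -scalerAl.
have ef : GRing.comm e f.
  by apply: fc; apply: (commZ); apply: commrM; apply: commr_sym; apply: ec;
    exact: commZ.
pose h := f * e.
have hs : cstar h = h by rewrite cstarM fs es.
pose w := b * b * (e * e).
have hh : h * h = (1 - b * b) - d%:C%:A + (d / 3)%:C *: w.
  rewrite /h mulrA -(mulrA f) ef mulrA -mulrA ff.
  have -> : 1 - (1 - d / 3)%:C *: (b * b)
      = (1 - b * b) + (d / 3)%:C *: (b * b).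
    by rewrite rmorphB scalerBl scale1r opprB addrA addrAC.
  rewrite mulrDl -scalerAl; congr (_ + _).
  by rewrite ee mulrBr mulr1 -scalerAr bc.
have Nw : N w <= 2.
  apply: le_trans (cnormM _ _) _; rewrite Nbb mul1r ee.
  apply: le_trans (cnorm_triB _ _) _; rewrite cnorm1 cnormZr.
  by rewrite ger0_norm ?(ltW d0) //; lra.
have N1b : N (1 - b * b) <= 1.
  by have := @cnorm_reflect b 1 bs; rewrite scale1r; apply; rewrite Nbb; lra.
have Nwd : N ((d / 3)%:C *: w) <= 2 * d / 3.
  rewrite cnormZr ger0_norm; last by lra.
  have : d / 3 * N w <= d / 3 * 2 by rewrite ler_wpM2l //; lra.
  lra.
have Nhh : N (h * h) < 2 * (1 - d).
  rewrite hh; apply: le_lt_trans (cnormD _ _) _.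
  have := cnorm_triB (1 - b * b) d%:C%:A.
  by rewrite cnorm_real ger0_norm ?(ltW d0) //; lra.
have := cnorm_reflect hs Nhh.
have -> : (1 - d)%:C%:A - h * h = b * b - (d / 3)%:C *: w.
  rewrite hh opprD addrA; congr (_ - _).
  by rewrite rmorphB scalerBl scale1r opprB addrA subrK opprB addrC subrK.
have := cnormD (b * b - (d / 3)%:C *: w) ((d / 3)%:C *: w).
by rewrite subrK Nbb; lra.
Qed.

(** If both [|a| - a] and [-|a| - a] are invertible, then so is their product
    [a^2 - |a|^2]. *)
Lemma cnorm_in_spectrum a : cstar a = a -> a != 0 ->
  spectrum a (N a)%:C \/ spectrum a (- N a)%:C.
Proof.
move=> aS a0; apply: contrapT => /not_orP[/contrapT inv1 /contrapT inv2].
have Na : 0 < N a.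
  rewrite lt_neqAle cnorm_ge0 andbT eq_sym; apply: contra_neq a0.
  exact: cnorm0_eq0.
pose b := (N a)^-1%:C *: a.
have bs : cstar b = b by rewrite cstarZr aS.
apply: (oneB_sqr_not_invertible bs).
  by rewrite cnormZr ger0_norm ?invr_ge0 ?cnorm_ge0 // mulVf ?gt_eqF.
have -> : 1 - b * b =
    (- (N a)^-1 ^+ 2)%:C *: (((N a)%:C%:A - a) * ((- N a)%:C%:A - a)).
  have -> : ((N a)%:C%:A - a) * ((- N a)%:C%:A - a) = a * a - (N a ^+ 2)%:C%:A.
    rewrite rmorphN /= scaleNr -opprD mulrN mulrBl !mulrDr.
    rewrite -!scalerAl -!scalerAr !mul1r !mulr1 scalerA opprB.
    rewrite [X in X - _]addrC [X in _ - X]addrC addrKA.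
    by rewrite -rmorphM expr2.
  rewrite rmorphN scaleNr scalerBr opprB scalerA -rmorphM -exprMn.
  rewrite mulVf ?gt_eqF // expr1n scale1r; congr (_ - _).
  by rewrite /b -scalerAl -scalerAr scalerA -rmorphM expr2.
apply: cinvertibleZ; last exact: cinvertibleM.
rewrite -(rmorph0 (real_complex R)) (inj_eq (@complexI R)) oppr_eq0.
by rewrite expf_neq0 // invr_eq0 gt_eqF.
Qed.

End CstarOrder.

(** * The positive cone *)

Section PositiveCone.
Context {R : realType} {A : cstarAlgType R}.
Local Notation N := (@cnorm R A).
Implicit Types (a b c : A) (r s t : R).
Local Open Scope complex_scope.

Lemma cpositiveP a : cstar a = a ->
  (forall t, spectrum a t%:C -> 0 <= t) -> cpositive a.
Proof.
move=> aS aP; split=> // l la; have lE := spectrum_real aS la.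
by rewrite lE ler0c; apply: aP; rewrite -lE.
Qed.

Lemma cpositive_spectrum a t : cpositive a -> spectrum a t%:C -> 0 <= t.
Proof. by move=> [_ aP] /aP; rewrite ler0c. Qed.

Lemma spectrum_reflectr a r t :
  spectrum (r%:C%:A - a) t%:C -> spectrum a (r - t)%:C.
Proof. by move/spectrum_reflect; rewrite rmorphB. Qed.

Lemma spectrum_reflectl a r t :
  spectrum a t%:C -> spectrum (r%:C%:A - a) (r - t)%:C.
Proof. by move=> ta; apply: spectrum_reflectr; rewrite opprB addrC subrK. Qed.

Lemma cstar_real r : cstar (r%:C%:A : A) = r%:C%:A.
Proof. by rewrite cstarZr cstar1. Qed.

Lemma spectrum_ler a t : spectrum a t%:C -> `|t| <= N a.
Proof.
move=> /spectrum_le_cnorm; rewrite -lecR; congr (_ <= _).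
by rewrite normc_def /= expr0n addr0 sqrtr_sqr.
Qed.

(** Together with its converse [normB_cpositive], this describes positivity by
    the norm alone: a self-adjoint [a] of norm at most [r] is positive exactly
    when [|r - a| <= r].  In this form stability under sums is the triangle
    inequality. *)
Lemma cpositive_normB a r : cpositive a -> N a <= r -> N (r%:C%:A - a) <= r.
Proof.
move=> aP ar; have r0 : 0 <= r := le_trans (cnorm_ge0 a) ar.
set c := _ - a; have [->|c0] := eqVneq c 0.
  by rewrite (is_norm0 cnorm_is_norm).
have cs : cstar c = c by rewrite cstarB cstar_real aP.1.
have [/spectrum_reflectr|/spectrum_reflectr] := cnorm_in_spectrum cs c0.
  by move/(cpositive_spectrum aP); rewrite subr_ge0.
move/spectrum_ler; rewrite opprK => h.
by have := ler_norm (r + N c); lra.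
Qed.

Lemma normB_cpositive a r : cstar a = a -> N (r%:C%:A - a) <= r -> cpositive a.
Proof.
move=> aS ar; apply: cpositiveP => // t ta.
have := spectrum_ler (spectrum_reflectl (r := r) ta).
by have := ler_norm (r - t); lra.
Qed.

Lemma cpositiveD a b : cpositive a -> cpositive b -> cpositive (a + b).
Proof.
move=> aP bP; apply: (@normB_cpositive _ (N a + N b)).
  by rewrite cstarD aP.1 bP.1.
rewrite rmorphD scalerDl opprD addrACA; apply: le_trans (cnormD _ _) _.
by rewrite lerD // cpositive_normB.
Qed.

Lemma cpositiveZ r a : 0 <= r -> cpositive a -> cpositive (r%:C *: a).
Proof.
move=> r0 aP; apply: (@normB_cpositive _ (r * N a)).
  by rewrite cstarZr aP.1.
rewrite rmorphM -scalerA -scalerBr cnormZr ger0_norm // ler_wpM2l //.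
exact: cpositive_normB.
Qed.

Lemma cpositive_closed a :
  (forall e, 0 < e -> cpositive (a + e%:C%:A)) -> cpositive a.
Proof.
move=> aP; apply: cpositiveP.
  have [/eqP + _] := aP 1 ltr01.
  by rewrite cstarD cstar_real => /eqP/addIr.
move=> t ta; apply/ler_addgt0Pr => e e0.
have := @spectrum_shift _ _ a e%:C _ ta; rewrite -rmorphD.
exact/cpositive_spectrum/aP.
Qed.

Lemma cle_cnorm a r : cstar a = a -> N a <= r -> cle a r%:C%:A.
Proof.
move=> aS ar; apply: (@normB_cpositive _ r).
  by rewrite cstarB cstar_real aS.
by rewrite opprB addrC subrK.
Qed.

Lemma cle_trans a b c : cle a b -> cle b c -> cle a c.
Proof.
by move=> ab bc; have := cpositiveD bc ab; rewrite addrA subrK.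
Qed.

Lemma cleD a b c d : cle a b -> cle c d -> cle (a + c) (b + d).
Proof. by rewrite /cle opprD addrACA; exact: cpositiveD. Qed.

Lemma cleZ r a b : 0 <= r -> cle a b -> cle (r%:C *: a) (r%:C *: b).
Proof. by rewrite /cle -scalerBr; exact: cpositiveZ. Qed.

Lemma cle_refl a : cstar a = a -> cle a a.
Proof.
move=> aS; rewrite /cle subrr; apply: (@normB_cpositive _ 0).
  exact: cstar0.
by rewrite rmorph0 scale0r subrr (is_norm0 cnorm_is_norm).
Qed.

Lemma cle_scale a r s : cpositive a -> r <= s -> cle (r%:C *: a) (s%:C *: a).
Proof.
move=> aP rs; rewrite /cle -scalerBl -rmorphB.
by apply: cpositiveZ; rewrite ?subr_ge0.
Qed.

Lemma cnorm_le_of_cle a r : cstar a = a -> cle a r%:C%:A -> cle (- a) r%:C%:A ->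
  N a <= r.
Proof.
move=> aS ar nar; have [->|a0] := eqVneq a 0.
  rewrite (is_norm0 cnorm_is_norm).
  have := cpositiveD ar nar; rewrite addrACA -opprD subrr subr0.
  rewrite -scalerDl -rmorphD => rr.
  have sp : spectrum ((r + r)%:C%:A : A) (r + r)%:C.
    by move=> [b []]; rewrite subrr mul0r => /esym/eqP; rewrite oner_eq0.
  by have := cpositive_spectrum rr sp; lra.
have neg t : spectrum a t%:C -> spectrum (- a) (- t)%:C.
  by move/(@spectrum_reflectl _ 0); rewrite rmorph0 scale0r !sub0r.
have [h|h] := cnorm_in_spectrum aS a0.
  by have := cpositive_spectrum ar (spectrum_reflectl (r := r) h); lra.
by have := cpositive_spectrum nar (spectrum_reflectl (r := r) (neg _ h)); lra.
Qed.

End PositiveCone.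

(** * Hilbert modules: Cauchy-Schwarz and the norm *)

Section HilbertModule.
Context {R : realType} {A : cstarAlgType R} {H : hilbertModType A}.
Local Notation N := (@cnorm R A).
Implicit Types (a b : A) (f g h : H) (r s t : R) (k : R[i]).
Local Open Scope complex_scope.

Lemma hinnerDl f g h : hinner (f + g) h = hinner f h + hinner g h.
Proof. by rewrite -[f]scale1r hinner_linearl mul1r scale1r. Qed.

Lemma hinner0l h : hinner (0 : H) h = 0.
Proof. by apply: (@addIr _ (hinner 0 h)); rewrite -hinnerDl !add0r. Qed.

Lemma hinnerZl a f h : hinner (a *: f) h = a * hinner f h.
Proof. by rewrite -[a *: f]addr0 hinner_linearl hinner0l addr0. Qed.

Lemma hinnerNl f h : hinner (- f) h = - hinner f h.
Proof. by rewrite -scaleN1r hinnerZl mulN1r. Qed.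

Lemma hinnerBl f g h : hinner (f - g) h = hinner f h - hinner g h.
Proof. by rewrite hinnerDl hinnerNl. Qed.

Lemma hinnerDr f g h : hinner h (f + g) = hinner h f + hinner h g.
Proof. by rewrite -hinner_sym hinnerDl cstarD !hinner_sym. Qed.

Lemma hinnerNr f h : hinner h (- f) = - hinner h f.
Proof. by rewrite -hinner_sym hinnerNl cstarN hinner_sym. Qed.

Lemma hinnerBr f g h : hinner h (f - g) = hinner h f - hinner h g.
Proof. by rewrite hinnerDr hinnerNr. Qed.

Lemma hinnerZr a f h : hinner h (a *: f) = hinner h f * cstar a.
Proof. by rewrite -hinner_sym hinnerZl cstarM hinner_sym. Qed.

Lemma hinnerCl k f h : hinner (k%:A *: f) h = k *: hinner f h.
Proof. by rewrite hinnerZl -scalerAl mul1r. Qed.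

Lemma hinnerRr r f h : hinner h (r%:C%:A *: f) = r%:C *: hinner h f.
Proof. by rewrite hinnerZr cstar_real -scalerAr mulr1. Qed.

Lemma hinner_ir f h : hinner h ('i%R%:A *: f) = - ('i%R *: hinner h f).
Proof. by rewrite hinnerZr cstarZi cstar1 mulrN -scalerAr mulr1. Qed.

Lemma hinner_eqr f g : (forall h, hinner h f = hinner h g) -> f = g.
Proof.
move=> fg; apply/eqP; rewrite -subr_eq0; apply/eqP; apply: hinner_eq0.
by rewrite hinnerBr fg subrr.
Qed.

Lemma hinner_eql f g : (forall h, hinner f h = hinner g h) -> f = g.
Proof.
by move=> fg; apply: hinner_eqr => h; rewrite -hinner_sym fg hinner_sym.
Qed.

Definition hnorm f := Num.sqrt (N (hinner f f)).

Lemma hnorm_sqr f : hnorm f ^+ 2 = N (hinner f f).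
Proof. by rewrite sqr_sqrtr // cnorm_ge0. Qed.

Lemma hnorm_ge0 f : 0 <= hnorm f.
Proof. exact: sqrtr_ge0. Qed.

Lemma hnormZr r f : hnorm (r%:C%:A *: f) = `|r| * hnorm f.
Proof.
rewrite /hnorm hinnerCl hinnerRr !cnormZr mulrA -expr2 sqrtrM ?sqr_ge0 //.
by rewrite real_normK ?num_real // sqrtr_sqr.
Qed.

Lemma hnormZi f : hnorm ('i%R%:A *: f) = hnorm f.
Proof. by rewrite /hnorm hinnerCl hinner_ir scalerN cnormN !cnormZi. Qed.

Lemma cle_re_hinner f g :
  cle (hinner f g + hinner g f) (hinner f f + hinner g g).
Proof.
have := hinner_ge0 (f - g); congr (cpositive _).
by rewrite hinnerBl !hinnerBr opprB addrACA -opprD.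
Qed.

Lemma cstar_re_hinner f g :
  cstar (hinner f g + hinner g f) = hinner f g + hinner g f.
Proof. by rewrite cstarD !hinner_sym addrC. Qed.

Lemma cle_hinner_hnorm f : cle (hinner f f) (hnorm f ^+ 2)%:C%:A.
Proof. by apply: cle_cnorm; rewrite ?hinner_sym // hnorm_sqr. Qed.

(** The square <t f - g, t f - g> is positive for every real [t], and so is
    <t f + g, t f + g>; hence [t n <= t^2 |f|^2 + |g|^2], where [n] is the norm
    on the left, and the discriminant gives the bound. *)
Lemma cnorm_re_hinner_le f g :
  N (hinner f g + hinner g f) <= 2 * hnorm f * hnorm g.
Proof.
have sum_bound u v : N (hinner u v + hinner v u) <= hnorm u ^+ 2 + hnorm v ^+ 2.
  have sq w : cle (hinner u u + hinner w w) (hnorm u ^+ 2 + hnorm w ^+ 2)%:C%:A.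
    by rewrite rmorphD scalerDl; apply: cleD; exact: cle_hinner_hnorm.
  apply: cnorm_le_of_cle; first exact: cstar_re_hinner.
    exact: cle_trans (cle_re_hinner u v) (sq v).
  have := cle_trans (cle_re_hinner u (- v)) (sq (- v)).
  by rewrite !hinnerNl !hinnerNr -opprD /hnorm hinnerNl hinnerNr opprK.
set n := N _; have n0 : 0 <= n := cnorm_ge0 _.
have quad t : t * n <= t ^+ 2 * hnorm f ^+ 2 + hnorm g ^+ 2.
  have := sum_bound (t%:C%:A *: f) g.
  rewrite hinnerCl hinnerRr -scalerDr cnormZr hnormZr exprMn.
  rewrite real_normK ?num_real // -/n; apply: le_trans.
  by rewrite ler_wpM2r // ler_norm.
have f0 := hnorm_ge0 f; have g0 := hnorm_ge0 g.
have [f_0|fN0] := eqVneq (hnorm f) 0.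
  rewrite f_0 mulr0 mul0r leNgt; apply/negP => n_gt0.
  have := quad ((hnorm g ^+ 2 + 1) / n).
  by rewrite f_0 expr0n mulr0 divfK ?gt_eqF //; lra.
have {fN0} f_gt0 : 0 < hnorm f by rewrite lt_neqAle eq_sym fN0.
rewrite -(@ler_pXn2r _ 2) ?nnegrE ?mulr_ge0 //.
have := quad (n / (2 * hnorm f ^+ 2)).
have -> : n / (2 * hnorm f ^+ 2) * n = 2 * (n ^+ 2 / (4 * hnorm f ^+ 2)).
  by field; rewrite gt_eqF.
have -> : (n / (2 * hnorm f ^+ 2)) ^+ 2 * hnorm f ^+ 2
        = n ^+ 2 / (4 * hnorm f ^+ 2).
  by field; rewrite gt_eqF.
move=> h; have {h} : n ^+ 2 / (4 * hnorm f ^+ 2) <= hnorm g ^+ 2 by lra.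
rewrite ler_pdivrMr ?mulr_gt0 ?exprn_gt0 // => /le_trans; apply.
by rewrite le_eqVlt; apply/orP; left; apply/eqP; ring.
Qed.

(** The constant 2 comes from splitting <f, g> into its real and imaginary parts
    and bounding them separately, which spares the inequality
    [a c a^* <= |c| a a^*]. *)
Lemma cauchy_schwarz f g : N (hinner f g) <= 2 * hnorm f * hnorm g.
Proof.
have h1 := cnorm_re_hinner_le f g.
have h2 := cnorm_re_hinner_le f ('i%R%:A *: g); rewrite hnormZi in h2.
have := cnormD (hinner f g + hinner g f)
  ('i%R *: (hinner f ('i%R%:A *: g) + hinner ('i%R%:A *: g) f)).
have -> : hinner f g + hinner g f +
   'i%R *: (hinner f ('i%R%:A *: g) + hinner ('i%R%:A *: g) f)
   = (2 : R)%:C *: hinner f g.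
  rewrite hinner_ir hinnerCl scalerDr scalerN !scalerA -expr2 sqrCi !scaleN1r.
  rewrite opprK [hinner f g - _]addrC addrA addrK.
  by rewrite rmorph_nat scaler_nat mulr2n.
by rewrite cnormZi cnormZr ger0_norm //; lra.
Qed.

Lemma hnorm_is_norm : is_norm hnorm.
Proof.
split.
- by rewrite /hnorm hinner0l (is_norm0 cnorm_is_norm) sqrtr0.
- by move=> f; rewrite /hnorm hinnerNl hinnerNr opprK.
- move=> f g; rewrite -(@ler_pXn2r _ 2) ?nnegrE ?addr_ge0 ?hnorm_ge0 //.
  rewrite hnorm_sqr hinnerDl !hinnerDr [hinner g f + _]addrC addrACA.
  apply: le_trans (cnormD _ _) _; have := cnorm_re_hinner_le f g.
  have := cnormD (hinner f f) (hinner g g); rewrite -!hnorm_sqr sqrrD.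
  rewrite -mulr_natl; lra.
- move=> f /eqP; rewrite sqrtr_eq0 => f0.
  by apply/hinner_eq0/cnorm0_eq0/eqP; rewrite eq_le f0 cnorm_ge0.
Qed.

End HilbertModule.

(** * Operators with an adjoint *)

Section Adjointable.
Context {R : realType} {A : cstarAlgType R} {H : hilbertModType A}.
Local Notation N := (@cnorm R A).
Implicit Types (f g h : H) (r s t : R).
Local Open Scope complex_scope.

(** A gliding hump.  If no [K] works, pick [V n] among the [U i] with
    [|V n| > 2 n 5^n p i], and build [x] by adding at step [n] a vector of norm
    [5^-n] along [V n], with the sign that makes the norm of <V n, x> at least
    [5^-n |V n|].  The later steps move [x] by at most [5^-n / 4], which
    costs at most half of this because of the constant in [cauchy_schwarz], so
    the norm of <V n, l> exceeds [n p i] at the limit [l].  The weights [p] allow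
    bounds below as well as bounds above. *)
Lemma uniform_boundedness (I : Type) (U : I -> H) (p : I -> R) :
  (forall i, 0 <= p i) ->
  (forall g, exists K, forall i, N (hinner (U i) g) <= K * p i) ->
  exists2 K, 0 < K & forall i, hnorm (U i) <= K * p i.
Proof.
move=> p0 pointwise; apply: contrapT => unbounded.
have escape (n : nat) : exists i, n%:R * 2 * 5 ^+ n * p i < hnorm (U i).
  apply: contrapT => none; apply: unbounded.
  exists (n%:R * 2 * 5 ^+ n + 1).
    by rewrite ltr_wpDl // !mulr_ge0 // exprn_ge0.
  move=> i; rewrite leNgt; apply/negP => h; apply: none; exists i.
  by apply: le_lt_trans h; rewrite ler_wpM2r // lerDl.
have [v vP] := choice escape; pose V n := U (v n).
have V0 n : 0 < hnorm (V n).
  by apply: le_lt_trans (vP n); rewrite !mulr_ge0 // exprn_ge0.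
pose w n := ((5^-1) ^+ n / hnorm (V n))%:C%:A *: V n.
have q0 n : 0 <= (5^-1 : R) ^+ n by rewrite exprn_ge0 // invr_ge0.
have wn n : hnorm (w n) = (5^-1) ^+ n.
  rewrite hnormZr ger0_norm; last by rewrite divr_ge0 ?hnorm_ge0.
  by rewrite divfK ?gt_eqF.
have Vw n : N (hinner (V n) (w n)) = (5^-1) ^+ n * hnorm (V n).
  rewrite hinnerRr cnormZr ger0_norm; last by rewrite divr_ge0 ?hnorm_ge0.
  by rewrite -hnorm_sqr expr2 mulrA divfK ?gt_eqF.
pose next n x := if (5^-1) ^+ n * hnorm (V n) <= N (hinner (V n) (x + w n))
  then x + w n else x - w n.
have next_big n x : (5^-1) ^+ n * hnorm (V n) <= N (hinner (V n) (next n x)).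
  rewrite /next; case: ifP => // /negbT; rewrite -ltNge => small.
  have := cnorm_triB (hinner (V n) (x + w n)) (hinner (V n) (x - w n)).
  rewrite -hinnerBr opprB [_ + (w n - x)]addrC addrA subrK.
  have -> : w n + w n = (2%:R : R)%:C%:A *: w n.
    by rewrite rmorph_nat [2%:R%:A]scaler_nat scaler_nat mulr2n.
  rewrite hinnerRr cnormZr ger0_norm // Vw; lra.
pose x := nat_rect (fun=> H) 0 next.
have [||l lP] := @geometric_step_cvg _ _ _ (@hnorm_is_norm _ _ H)
  hinner_complete x 1 5^-1.
- by apply/andP; split; lra.
- move=> n; rewrite mul1r -wn /= /next; case: ifP => _.
    by rewrite addrAC subrr add0r.
  by rewrite addrAC subrr add0r (is_normN hnorm_is_norm).
have [K KP] := pointwise l.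
pose n := (Num.truncn `|K|).+1.
have nK : K <= n%:R.
  by apply: le_trans (ler_norm K) _; apply: ltW; exact: truncnS_gt.
have := vP n; apply/negP; rewrite -leNgt -/(V n).
have := KP (v n); rewrite -/(V n) => lbound.
have := next_big n (x n); rewrite -[next n (x n)]/(x n.+1) => big.
have := cnorm_triB (hinner (V n) l) (hinner (V n) (l - x n.+1)).
rewrite -hinnerBr opprB addrC subrK => tri.
have cs := cauchy_schwarz (V n) (l - x n.+1).
have dist : hnorm (l - x n.+1) <= (5^-1) ^+ n / 4.
  apply: le_trans (lP n.+1) _; rewrite exprS.
  by rewrite le_eqVlt; apply/orP; left; apply/eqP; field.
have := ler_wpM2l (ltW (V0 n)) dist => dist'.
have Kn : K * p (v n) <= n%:R * p (v n) by rewrite ler_wpM2r.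
have half : (5^-1) ^+ n * hnorm (V n) <= 2 * (n%:R * p (v n)) by lra.
have := ler_wpM2l (exprn_ge0 n (ler0n R 5)) half.
by rewrite [5 ^+ n * (_ * hnorm _)]mulrA -exprMn mulfV ?expr1n ?mul1r //; lra.
Qed.

Definition adjoint_pair (T S : H -> H) :=
  forall f g, hinner (T f) g = hinner f (S g).

Lemma adjoint_pair_sym T S : adjoint_pair T S -> adjoint_pair S T.
Proof. by move=> TS f g; rewrite -hinner_sym -TS hinner_sym. Qed.

Lemma adjoint_pair_comp T S T' S' : adjoint_pair T S -> adjoint_pair T' S' ->
  adjoint_pair (T \o T') (S' \o S).
Proof. by move=> TS T'S' f g /=; rewrite TS T'S'. Qed.

Lemma adjoint_pairB T S : adjoint_pair T S -> {morph T : f g / f - g}.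
Proof.
by move=> TS f g; apply: hinner_eql => h; rewrite hinnerBl !TS hinnerBl.
Qed.

Lemma adjoint_pair_bounded T S : adjoint_pair T S ->
  exists2 K, 0 < K & forall f, hnorm (T f) <= K * hnorm f.
Proof.
move=> TS; apply: uniform_boundedness => [f|g]; first exact: hnorm_ge0.
exists (2 * hnorm (S g)) => f; rewrite TS.
by rewrite (le_trans (cauchy_schwarz _ _)) // mulrAC.
Qed.

(** Vectors are controlled by their inner products with the range of [T], which
    is everything, and <f, T g> = <S f, g>. *)
Lemma adjoint_bounded_below T S :
  adjoint_pair T S -> (forall g, exists f, T f = g) ->
  exists2 K, 0 < K & forall f, hnorm f <= K * hnorm (S f).
Proof.
move=> TS Tsurj; apply: uniform_boundedness => [f|g]; first exact: hnorm_ge0.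
have [f' <-] := Tsurj g; exists (2 * hnorm f') => f.
rewrite -(adjoint_pair_sym TS).
by rewrite (le_trans (cauchy_schwarz _ _)) // mulrAC.
Qed.

(** From <f - X f, f - X f> >= 0 one gets 2 <X f, f> <= <f, f> + <X^2 f, f>,
    and [X^2] is again a symmetric contraction.  After [m] rounds the error
    left is [2^-m] times the bound given by [cauchy_schwarz]. *)
Lemma cle_symmetric_contraction (X : H -> H) :
  adjoint_pair X X -> (forall f, hnorm (X f) <= hnorm f) ->
  forall f, cle (hinner (X f) f) (hinner f f).
Proof.
move=> Xs Xn f.
have iter_bound (m : nat) : cle (hinner (X f) f)
    (hinner f f + (2^-1 ^+ m * (2 * hnorm f ^+ 2))%:C%:A).
  elim: m X Xs Xn => [|m IH] X Xs Xn.
    rewrite -[hinner (X f) f]add0r; apply: cleD.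
      by rewrite /cle subr0; exact: hinner_ge0.
    apply: cle_cnorm; first by rewrite hinner_sym Xs.
    rewrite expr0 mul1r expr2 mulrA; apply: le_trans (cauchy_schwarz _ _) _.
    by rewrite ler_wpM2r ?hnorm_ge0 // ler_wpM2l.
  have XX := IH (X \o X) (adjoint_pair_comp Xs Xs)
    (fun f => le_trans (Xn _) (Xn f)).
  have := cle_re_hinner f (X f); rewrite -(Xs f f) -(Xs (X f) f) => h.
  have {h} := cle_trans h (cleD (cle_refl (hinner_sym f f)) XX).
  have half : 0 <= 2^-1 :> R by rewrite invr_ge0.
  move=> /(cleZ half); congr (cle _ _).
    exact: scaler_half.
  rewrite addrA scalerDr scaler_half; congr (_ + _).
  by rewrite scalerA -rmorphM mulrA -exprS.
apply: cpositive_closed => e e0; rewrite addrAC.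
have qP : 0 <= (2^-1 : R) < 1 by apply/andP; split; lra.
have e2 : 0 < e * 2 by lra.
have [n ne] := geometric_tail_small (2 * hnorm f ^+ 2) qP e2.
have : cle (hinner f f + (2^-1 ^+ n * (2 * hnorm f ^+ 2))%:C%:A)
    (hinner f f + e%:C%:A).
  apply: cleD; first exact: cle_refl (hinner_sym f f).
  have onep : cpositive (1 : A).
    apply: (@normB_cpositive _ _ _ 1); rewrite ?cstar1 //.
    by rewrite scale1r subrr (is_norm0 cnorm_is_norm).
  apply: cle_scale => //; rewrite mulrC ltW // -(@ltr_pM2r _ 2) //.
  by move: ne; rewrite (_ : (1 - 2^-1)^-1 = 2 :> R) //; field.
by move/(cle_trans (iter_bound n)).
Qed.

(** A multiple of [S T] is a symmetric contraction, and
    <S (T f), f> = <T f, T f>. *)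
Lemma adjoint_pair_cle T S : adjoint_pair T S ->
  exists2 c, 1 <= c & forall f, cle (hinner (T f) (T f)) (c%:C *: hinner f f).
Proof.
move=> TS; have ST := adjoint_pair_sym TS.
have PP := adjoint_pair_comp ST TS.
have [K K0 KP] := adjoint_pair_bounded PP.
pose c := K + 1; have c0 : 0 < c by rewrite /c; lra.
exists c => [|f]; first by rewrite /c; lra.
pose X f := (c^-1)%:C%:A *: S (T f).
have Xs : adjoint_pair X X.
  by move=> u v; rewrite hinnerCl hinnerRr ST TS.
have Xn u : hnorm (X u) <= hnorm u.
  rewrite hnormZr ger0_norm ?invr_ge0 ?(ltW c0) // ler_pdivrMl //.
  by apply: le_trans (KP u) _; rewrite ler_wpM2r ?hnorm_ge0 // /c; lra.
have := cleZ (ltW c0) (cle_symmetric_contraction Xs Xn f).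
by rewrite hinnerCl ST scalerA -rmorphM mulfV ?gt_eqF // scale1r.
Qed.

(** If [J] is a right inverse of [B], then [B f = g + E f] is solved by a fixed
    point of the map sending [f] to [J (g + E f)], a contraction of constant
    1/2. *)
Lemma surjective_perturbation (B E : H -> H) (q : R) : 0 < q ->
  (forall f g, q * hnorm (f - g) <= hnorm (B f - B g)) ->
  (forall f g, hnorm (E f - E g) <= q / 2 * hnorm (f - g)) ->
  (forall g, exists f, B f = g) -> forall g, exists f, B f = g + E f.
Proof.
move=> q0 Bq Eq /choice[J JP] g.
have [|||||f _ fP] := contraction_fixpoint (@hnorm_is_norm _ _ H)
  hinner_complete (K := fun=> True) (F := fun f => J (g + E f))
  (q := 2^-1); rewrite //.
- by apply/andP; split; lra.
- move=> u v _ _; rewrite -(ler_pM2l q0); apply: le_trans (Bq _ _) _.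
  rewrite !JP opprD addrACA subrr add0r mulrA; exact: Eq.
by exists f; rewrite -{1}fP JP.
Qed.

(** Since <(T S + t) f, f> = <S f, S f> + t <f, f> dominates <S f, S f>, the
    bound below of [S] makes [T S + t] bounded below by a constant [q] independent
    of [t >= 0].  [T S + t] is a small perturbation of [t] for large [t], and
    surjectivity passes from [t + q / 2] to [t].  At [t = 0], solving
    [T S f = T g] and cancelling [T] yields [S f = g]. *)
Lemma adjoint_surjective T S : adjoint_pair T S -> bijective T ->
  forall g, exists f, S f = g.
Proof.
move=> TS [T' TK T'K]; have ST := adjoint_pair_sym TS.
have [K K0 KP] := adjoint_bounded_below TS (fun g => ex_intro _ (T' g) (T'K g)).
have PP := adjoint_pair_comp TS ST.
have [M M0 MP] := adjoint_pair_bounded PP.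
pose B t f := T (S f) + t%:C%:A *: f.
have BB t f g : B t f - B t g = B t (f - g).
  by rewrite /B (adjoint_pairB ST) (adjoint_pairB TS) opprD addrACA scalerBr.
pose q := (2 * K ^+ 2)^-1.
have q0 : 0 < q by rewrite invr_gt0 mulr_gt0 ?exprn_gt0.
have lower t f g : 0 <= t -> q * hnorm (f - g) <= hnorm (B t f - B t g).
  move=> t0; rewrite BB; move: (f - g) => {f}{}g.
  have [->|g0] := eqVneq (hnorm g) 0; first by rewrite mulr0 hnorm_ge0.
  have {}g0 : 0 < hnorm g by rewrite lt_neqAle eq_sym g0 hnorm_ge0.
  have : N (hinner (S g) (S g)) <= N (hinner (B t g) g).
    have SSp := hinner_ge0 (S g).
    have sum : hinner (B t g) g = hinner (S g) (S g) + t%:C *: hinner g g.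
      by rewrite hinnerDl hinnerCl TS.
    have ab : cle (hinner (S g) (S g)) (hinner (B t g) g).
      rewrite /cle sum addrAC subrr add0r.
      by apply: cpositiveZ => //; exact: hinner_ge0.
    have le_norm : cle (hinner (B t g) g) (N (hinner (B t g) g))%:C%:A.
      by apply: cle_cnorm => //; rewrite sum cstarD cstarZr !hinner_sym.
    apply: cnorm_le_of_cle; first by rewrite hinner_sym.
      exact: cle_trans le_norm.
    apply: cle_trans (cle_trans ab le_norm).
    by rewrite /cle opprK; exact: cpositiveD.
  move=> /le_trans/(_ (cauchy_schwarz _ _)); rewrite -hnorm_sqr => h.
  have : hnorm g ^+ 2 <= K ^+ 2 * hnorm (S g) ^+ 2.
    by rewrite -exprMn ler_pXn2r ?nnegrE ?mulr_ge0 ?hnorm_ge0 // ltW.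
  have := ler_wpM2l (sqr_ge0 K) h => h' /le_trans/(_ h').
  rewrite expr2 !mulrA ler_pM2r // => ?.
  by rewrite /q ler_pdivrMl ?mulr_gt0 ?exprn_gt0 // [2 * _]mulrC.
have surj (n : nat) : forall t, 0 <= t -> 2 * M <= t + n%:R * (q / 2) ->
    forall g, exists f, B t f = g.
  elim: n => [|n IH] t t0 tM g.
    rewrite mul0r addr0 in tM; have t_gt0 : 0 < t by lra.
    have [|||f fP] := @surjective_perturbation (fun f => t%:C%:A *: f)
        (fun f => - T (S f)) t t_gt0 _ _ _ g.
    - by move=> u v; rewrite -scalerBr hnormZr ger0_norm.
    - move=> u v; rewrite -opprD (is_normN hnorm_is_norm).
      rewrite -(adjoint_pairB TS) -(adjoint_pairB ST).
      by apply: le_trans (MP _) _; rewrite ler_wpM2r ?hnorm_ge0 //; lra.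
    - move=> u; exists ((t^-1)%:C%:A *: u).
      rewrite scalerA -scalerAl mul1r scalerA -rmorphM.
      by rewrite mulfV ?gt_eqF // !scale1r.
    by exists f; rewrite /B fP addrCA subrr addr0.
  have [|||f fP] := @surjective_perturbation (B (t + q / 2))
      (fun f => (q / 2)%:C%:A *: f) q q0 _ _ _ g.
  - by move=> u v; apply: lower; lra.
  - by move=> u v; rewrite -scalerBr hnormZr ger0_norm //; lra.
  - by apply: IH; [lra | move: tM; rewrite -natr1; lra].
  exists f; move: fP; rewrite /B rmorphD scalerDl scalerDl addrA.
  exact: addIr.
pose n := (Num.truncn (2 * M / (q / 2))).+1.
have nM : 2 * M <= 0 + n%:R * (q / 2).
  by rewrite add0r -ler_pdivrMr ?ltW ?truncnS_gt //; lra.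
move=> g; have [f] := surj n 0 (lexx 0) nM (T g).
by rewrite /B scale0r scale0r addr0 => /(can_inj TK); exists f.
Qed.

Lemma adjointable_inverse T S T' : adjoint_pair T S ->
  cancel T T' -> cancel T' T ->
  exists S', [/\ adjoint_pair T' S', cancel S S' & cancel S' S].
Proof.
move=> TS TK T'K.
have /choice[S' S'P] := adjoint_surjective TS (Bijective TK T'K).
have T'S' : adjoint_pair T' S'.
  by move=> f g; rewrite -{1}(S'P g) -TS T'K.
exists S'; split => // f; apply: hinner_eqr => h.
by rewrite -T'S' -TS T'K.
Qed.

End Adjointable.

(** * Biframes *)

Section Biframe.
Context {R : realType} {A : cstarAlgType R} {H : hilbertModType A}.
Context {d : measure_display} {Omega : measurableType d}.
Variable mu : {measure set Omega -> \bar R}.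
Local Open Scope complex_scope.

(** The frame bounds of [(X, Y)] at [S f] are bounds in terms of <S f, S f>; the
    operator bounds of [S] and of its inverse turn them into bounds in terms of
    <f, f>. *)
Lemma continuous_biframe_comp (T : H -> H) (X Y : Omega -> H) :
  adjointable T -> bijective T ->
  continuous_biframe mu X Y -> continuous_biframe mu (T \o X) (T \o Y).
Proof.
move=> [S TS] [T' TK T'K] [meas [a [b [a0 ab bounds]]]].
have ST := adjoint_pair_sym TS.
have [S' [T'S' SK _]] := adjointable_inverse TS TK T'K.
have [c c1 cP] := adjoint_pair_cle ST.
have [c' c'1 c'P] := adjoint_pair_cle (adjoint_pair_sym T'S').
have c'0 : 0 < c' by lra.
have move_r f (Z : Omega -> H) :
    (fun w => hinner f ((T \o Z) w)) = (fun w => hinner (S f) (Z w)).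
  by apply/funext => w; rewrite ST.
split=> [f|]; first by rewrite !move_r; exact: meas.
have b0 : 0 < b by lra.
exists (a / c'), (b * c); split; first exact: divr_gt0.
  rewrite ler_pdivrMr //; have := ler_wpM2l (ltW b0) c1.
  have : b * c * 1 <= b * c * c' by rewrite ler_wpM2l // mulr_ge0; lra.
  lra.
move=> f.
have -> : (fun w => hinner f ((T \o X) w) * hinner ((T \o Y) w) f)
        = (fun w => hinner (S f) (X w) * hinner (Y w) (S f)).
  by apply/funext => w /=; rewrite -ST TS.
have [intg lower upper] := bounds (S f); split=> //.
- apply: cle_trans lower.
  have := cleZ (ltW (divr_gt0 a0 c'0)) (c'P (S f)).
  by rewrite SK scalerA -rmorphM divfK ?gt_eqF.
- apply: (cle_trans upper).
  by have := cleZ (ltW b0) (cP f); rewrite scalerA -rmorphM.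
Qed.

End Biframe.

Unset Implicit Arguments.

Theorem theorem2p8 (R : realType) (A : cstarAlgType R) (H : hilbertModType A)
    (d : measure_display) (Omega : measurableType d)
    (mu : {measure set Omega -> \bar R})
    (T : H -> H) (T_adj : adjointable T) (T_inv : bijective T)
    (X Y : Omega -> H) :
  continuous_biframe mu X Y <-> continuous_biframe mu (T \o X) (T \o Y).
Proof.
split; first exact: continuous_biframe_comp.
have [S TS] := T_adj; have [T' TK T'K] := T_inv.
have [S' [T'S' _ _]] := adjointable_inverse TS TK T'K.
have cancel_comp (Z : Omega -> H) : T' \o (T \o Z) = Z.
  by apply/funext => w /=; rewrite TK.
rewrite -{2}(cancel_comp X) -{2}(cancel_comp Y).
apply: continuous_biframe_comp; [by exists S' | exact: Bijective T'K TK].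
Qed.
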